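(* Let $G$ be a graph and $(M,x)\in\mathcal{M}(G)$. If $G$ has an independent set $C$ such that $M[C]$ is diagonal and, with $c=\max_{u\in V(G)}\frac{(M)_{uu}}{x_u^2}$, one has $\frac{(M)_{vv}}{x_v^2}=c$ for all $v\in C$ and $c\,x_v=\sum_{u\in C}(M)_{vu}x_u^{-1}$ for all $v\notin C$, then $$\alpha(G)=\Theta(G)=\vartheta(G)=|C|=F(M,x).$$
   Context: $\alpha(G)$ is the independence number. $\mathcal{M}(G)$ is the set of pairs $(M,x)$ with $M$ a real positive semidefinite matrix indexed by $V(G)$ such that $(M)_{ij}=0$ for distinct nonadjacent $i,j$, and $x$ in the column space of $M$ with all entries nonzero. $M[C]$ is the principal submatrix indexed by $C$. $F(M,x)=x^\top M^\#x\max_{u}\frac{(M)_{uu}}{x_u^2}$, where $M^\#$ is the group inverse (unique $X$ with $MXM=M$, $XMX=X$, $MX=XM$). The Shannon capacity is $\Theta(G)=\lim_{k\to\infty}\alpha(G^k)^{1/k}$, where $G^k$ has vertex set $V^k$ and distinct $u_1\cdots u_k$, $v_1\cdots v_k$ are adjacent iff for each $i$ either $u_i=v_i$ or $u_iv_i\in E(G)$. $\vartheta(G)$ is the Lovász theta function: the minimum largest eigenvalue of a real symmetric matrix $A$ indexed by $V(G)$ with $(A)_{ij}=1$ whenever $i=j$ or $i,j$ are nonadjacent. *)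

(* Defs.v *)
From HB Require Import structures.
From mathcomp Require Import all_boot all_order all_algebra.
From mathcomp Require Import all_classical all_reals all_analysis.

Set Implicit Arguments.
Unset Strict Implicit.
Unset Printing Implicit Defensive.
Import Order.TTheory GRing.Theory Num.Theory.
Import numFieldNormedType.Exports.

Local Open Scope classical_set_scope.
Local Open Scope ring_scope.

Record sgraph := SGraph {
  vertex :> finType;
  adj : rel vertex;
  adj_sym : symmetric adj;
  adj_irrefl : irreflexive adj
}.

Definition independent (G : sgraph) (C : {set G}) : bool :=
  [forall u in C, forall v in C, ~~ adj u v].

Definition alpha (G : sgraph) : nat := \max_(C : {set G} | independent C) #|C|.

Section StrongPower.
Variables (G : sgraph) (k : nat).

Definition pow_adj : rel {ffun 'I_k -> G} :=
  fun u v => (u != v) && [forall i, (u i == v i) || adj (u i) (v i)].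

Lemma pow_adj_sym : symmetric pow_adj.
Proof.
move=> u v; rewrite /pow_adj eq_sym; congr (_ && _).
by apply: eq_forallb => i; rewrite eq_sym adj_sym.
Qed.

Lemma pow_adj_irrefl : irreflexive pow_adj.
Proof. by move=> u; rewrite /pow_adj eqxx. Qed.

Definition strong_power : sgraph := SGraph pow_adj_sym pow_adj_irrefl.

End StrongPower.

(* The term k = 0 of the sequence is irrelevant to the limit. *)
Definition shannon_capacity (R : realType) (G : sgraph) : R :=
  limn (fun k : nat => (alpha (strong_power G k))%:R `^ (k%:R^-1)).

(* A matrix indexed by V(G) is a square matrix of size #|V(G)| whose rows and *)
(* columns are labelled by the vertices through the bijection [enum_rank].    *)
Definition mx_entry (R : Type) (G : sgraph) (M : 'M[R]_#|G|) (u v : G) : R :=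
  M (enum_rank u) (enum_rank v).

Definition vec_entry (R : Type) (G : sgraph) (x : 'cV[R]_#|G|) (u : G) : R :=
  x (enum_rank u) ord0.

Definition principal_submx (R : Type) (G : sgraph) (C : {set G})
    (M : 'M[R]_#|G|) : 'M[R]_#|C| :=
  \matrix_(i, j) mx_entry M (enum_val i) (enum_val j).

Definition psd (R : realType) (n : nat) (M : 'M[R]_n) : Prop :=
  M^T = M /\ forall y : 'cV[R]_n, 0 <= (y^T *m M *m y) ord0 ord0.

(* The membership (M, x) \in \mathcal{M}(G). *)
Definition graph_pair (R : realType) (G : sgraph)
    (M : 'M[R]_#|G|) (x : 'cV[R]_#|G|) : Prop :=
  [/\ psd M,
      forall u v : G, u != v -> ~~ adj u v -> mx_entry M u v = 0,
      exists y : 'cV[R]_#|G|, x = M *m y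
    & forall u : G, vec_entry x u != 0].

Definition is_group_inverse (R : realType) (n : nat) (M X : 'M[R]_n) : Prop :=
  [/\ M *m X *m M = M, X *m M *m X = X & M *m X = X *m M].

(* Default value 0 when M has no group inverse, which does not happen for a   *)
(* symmetric real M.                                                          *)
Definition group_inverse (R : realType) (n : nat) (M : 'M[R]_n) : 'M[R]_n :=
  xget 0 [set X | is_group_inverse M X].

Lemma is_group_inverse_uniq (R : realType) (n : nat) (M X Y : 'M[R]_n) :
  is_group_inverse M X -> is_group_inverse M Y -> X = Y.
Proof.
move=> [mxm xmx cx] [mym ymy cy].
have eX : M *m X = (M *m Y) *m (M *m X) by rewrite mulmxA mym.
have eY : M *m Y = (M *m Y) *m (M *m X).
  by rewrite {2}cy cx -mulmxA (mulmxA M) mxm -cy.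
have e : M *m X = M *m Y by rewrite eX -eY.
by rewrite -xmx -mulmxA e mulmxA -cx e cy ymy.
Qed.

Lemma group_inverseP (R : realType) (n : nat) (M X : 'M[R]_n) :
  is_group_inverse M X -> group_inverse M = X.
Proof.
move=> MX; apply: (@is_group_inverse_uniq _ _ M) => //.
exact: (xgetPex 0 (ex_intro _ X MX)).
Qed.

(* The default 0 of the maximum only matters for the graph without vertices:  *)
(* the ratios are nonnegative when M is positive semidefinite.                *)
Definition max_ratio (R : realType) (G : sgraph)
    (M : 'M[R]_#|G|) (x : 'cV[R]_#|G|) : R :=
  \big[Num.max/0]_(u : G) (mx_entry M u u / vec_entry x u ^+ 2).

Definition F (R : realType) (G : sgraph)
    (M : 'M[R]_#|G|) (x : 'cV[R]_#|G|) : R :=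
  (x^T *m group_inverse M *m x) ord0 ord0 * max_ratio M x.

Definition is_largest_eigenvalue (R : realType) (n : nat) (A : 'M[R]_n)
    (t : R) : Prop :=
  eigenvalue A t /\ forall s : R, eigenvalue A s -> s <= t.

Definition lovasz_feasible (R : realType) (G : sgraph) (A : 'M[R]_#|G|) : Prop :=
  A^T = A /\ forall u v : G, (u == v) || ~~ adj u v -> mx_entry A u v = 1.

Definition lovasz_values (R : realType) (G : sgraph) : set R :=
  [set t | exists2 A : 'M[R]_#|G|, lovasz_feasible A & is_largest_eigenvalue A t].

Definition is_minimum (R : realType) (S : set R) (t : R) : Prop :=
  S t /\ forall s : R, S s -> t <= s.

(* Default value 0 when the minimum does not exist, which only happens for    *)
(* the graph without vertices.                                                *)
Definition lovasz_theta (R : realType) (G : sgraph) : R :=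
  xget 0 [set t | is_minimum (lovasz_values G) t].

Lemma lovasz_thetaP (R : realType) (G : sgraph) (t : R) :
  is_minimum (lovasz_values G) t -> lovasz_theta R G = t.
Proof.
move=> mt; have [St lt] := xgetPex 0 (ex_intro _ t mt).
by apply/le_anti/andP; split; [apply: lt; case: mt | apply: mt.2].
Qed.

(* Main.v *)
Require Import Defs.
From mathcomp Require Import all_boot all_order all_algebra.
From mathcomp Require Import all_classical all_reals all_analysis.
From mathcomp Require Import ring lra.

(* Rescale [M] to the kernel [f u v = M u v / (x u * x v)]: it is positive,     *)
(* its diagonal is at most [c], it vanishes at distinct nonadjacent vertices,   *)
(* and the hypotheses on [C] say that [w = 1_C / c] solves [f w = 1].  With     *)
(* [t = #|C| = c * sum w]:                                                      *)
(* - if [S] is independent, Cauchy-Schwarz for [1_S] and [w] gives              *)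
(*   [#|S|^2 <= (c #|S|) * sum w], so [#|S| <= t]; tensor powers of [f] and [w] *)
(*   satisfy the same conditions on [G^k] with bound [t^k], attained by [C^k],  *)
(*   so the sequence defining the Shannon capacity is eventually constant;      *)
(* - [A = J - (t / c) f + (t / c) diag f] is feasible for the theta function,   *)
(*   and Cauchy-Schwarz for [1_C] and [z] gives [A <= t], with eigenvector      *)
(*   [1_C]; conversely the Rayleigh quotient at [1_C] of any feasible matrix    *)
(*   is [t];                                                                    *)
(* - [x = M y] with [y = w / x], so [x^T M^# x = y^T x = t / c].                *)

Set Implicit Arguments.
Unset Strict Implicit.
Unset Printing Implicit Defensive.

Import Order.TTheory GRing.Theory Num.Theory.
Import numFieldNormedType.Exports.

Local Open Scope ring_scope.

(** Positive matrices are treated as kernels on an arbitrary finite type, so that the single bound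
    [independent_card_le] serves both [G] and its strong powers. The inequality behind every upper
    bound is Cauchy-Schwarz, [psd_kernel_cauchy]. Gram decompositions ([psd_kernel_gram]) make
    tensor powers positive, which carries the bound over to [G^k] in [alpha_strong_power_le] and so
    to the capacity. [lovasz_theta_eq] exhibits an optimal feasible matrix; its minimality rests on
    the variational bound [rayleigh_le]. [sym_group_inverse] supplies the inverse needed to evaluate
    [F]. *)

(** * Positive semidefinite kernels on a finite type *)

Definition bform (R : realType) (T : finType) (f : T -> T -> R) (z w : T -> R) : R :=
  \sum_u \sum_v z u * f u v * w v.

Definition psd_kernel (R : realType) (T : finType) (f : T -> T -> R) : Prop :=
  (forall u v, f u v = f v u) /\ forall z, 0 <= bform f z z.

Section PsdKernel.
Variables (R : realType) (T : finType).
Implicit Types (f : T -> T -> R) (z w : T -> R).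

Lemma bformE f z w : bform f z w = \sum_u z u * \sum_v f u v * w v.
Proof.
by apply: eq_bigr => u _; rewrite mulr_sumr; apply: eq_bigr => v _; rewrite mulrA.
Qed.

Lemma bformC f z w : (forall u v, f u v = f v u) -> bform f z w = bform f w z.
Proof.
move=> fC; rewrite /bform exchange_big; apply: eq_bigr => u _.
by apply: eq_bigr => v _; rewrite (fC v u); ring.
Qed.

Lemma bform_comb f z w (a b : R) : (forall u v, f u v = f v u) ->
  bform f (fun u => a * z u + b * w u) (fun u => a * z u + b * w u) =
  a ^+ 2 * bform f z z + 2 * a * b * bform f z w + b ^+ 2 * bform f w w.
Proof.
move=> fC.
have -> : 2 * a * b * bform f z w = a * b * bform f z w + a * b * bform f w z.
  by rewrite (bformC w) //; ring.
rewrite /bform !mulr_sumr -!big_split; apply: eq_bigr => u _ /=.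
rewrite !mulr_sumr -!big_split; apply: eq_bigr => v _ /=; ring.
Qed.

(** The form is nonnegative at every combination of [z] and [w]; suitable coefficients give the
    inequality, an isotropic [w] being treated apart. *)
Lemma psd_kernel_cauchy f z w : psd_kernel f ->
  bform f z w ^+ 2 <= bform f z z * bform f w w.
Proof.
move=> [fC f0].
have key a b := f0 (fun u => a * z u + b * w u).
have {}key a b : 0 <= a ^+ 2 * bform f z z + 2 * a * b * bform f z w
    + b ^+ 2 * bform f w w by rewrite -bform_comb.
have := f0 w; rewrite le_eqVlt => /orP[/eqP w0|w_gt0].
  rewrite -w0 mulr0.
  have [->|zw0] := eqVneq (bform f z w) 0; first by rewrite expr0n.
  (* With a nonzero mixed term this combination would have value [- bform f z z - 2], which is
     negative. *)
  have := key 1 (- (bform f z z + 1) / bform f z w).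
  rewrite -w0 mulr0 addr0 expr1n mul1r mulr1 -mulrA divfK // => h.
  have := f0 z; lra.
have := key (bform f w w) (- bform f z w).
have -> : bform f w w ^+ 2 * bform f z z + 2 * bform f w w * - bform f z w * bform f z w
    + (- bform f z w) ^+ 2 * bform f w w
  = bform f w w * (bform f z z * bform f w w - bform f z w ^+ 2) by ring.
by rewrite pmulr_rge0 // subr_ge0.
Qed.

Lemma sum_indic (a : T) (F : T -> R) : \sum_u (u == a)%:R * F u = F a.
Proof.
rewrite (bigD1 a) //= eqxx mul1r big1 ?addr0 // => u /negPf ->.
by rewrite mul0r.
Qed.

Lemma bform_indicl f (a : T) z :
  bform f (fun u => (u == a)%:R) z = \sum_v f a v * z v.
Proof. by rewrite bformE sum_indic. Qed.

Lemma bform_indic f (a b : T) :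
  bform f (fun u => (u == a)%:R) (fun u => (u == b)%:R) = f a b.
Proof.
by rewrite bform_indicl; under eq_bigr do rewrite mulrC; rewrite sum_indic.
Qed.

Lemma psd_kernel_diag_ge0 f u : psd_kernel f -> 0 <= f u u.
Proof. by move=> [_ /(_ (fun v => (v == u)%:R))]; rewrite bform_indic. Qed.

Lemma psd_kernel_diag0 f u v : psd_kernel f -> f u u = 0 -> f u v = 0.
Proof.
move=> psdf fu0.
have := psd_kernel_cauchy (fun t => (t == u)%:R) (fun t => (t == v)%:R) psdf.
rewrite !bform_indic fu0 mul0r => h.
by apply/eqP; rewrite -sqrf_eq0 eq_le h sqr_ge0.
Qed.

(** This is the Schur complement at [p]; it is positive by Cauchy-Schwarz for the indicator of [p]
    and [z]. *)
Lemma psd_kernel_deflate f p : psd_kernel f -> 0 < f p p ->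
  psd_kernel (fun u v => f u v - f p u * f p v / f p p).
Proof.
move=> psdf fp; have [fC f0] := psdf; split=> [u v|z]; first by rewrite (fC u v); ring.
have -> : bform (fun u v => f u v - f p u * f p v / f p p) z z =
    bform f z z - bform f (fun u => (u == p)%:R) z ^+ 2 / f p p.
  rewrite bform_indicl expr2 -mulrA mulr_suml -sumrB.
  apply: eq_bigr => u _; rewrite [_ / f p p]mulr_suml mulr_sumr -sumrB.
  by apply: eq_bigr => v _; ring.
rewrite subr_ge0 ler_pdivrMr // mulrC.
by have := psd_kernel_cauchy (fun u => (u == p)%:R) z psdf; rewrite bform_indic.
Qed.

(* Cholesky: each step subtracts a rank-one form killing one more diagonal    *)
(* entry, and vanishing diagonal entries stay zero by positivity.             *)
Lemma psd_kernel_gram f : psd_kernel f ->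
  exists s : seq (T -> R), forall u v, f u v = \sum_(g <- s) g u * g v.
Proof.
have [n] := ubnP #|[pred u | f u u != 0]|.
elim: n f => // n IH f; rewrite ltnS => fn psdf.
have [p fp|f0] := pickP [pred u | f u u != 0]; last first.
  exists [::] => u v; rewrite big_nil; apply: psd_kernel_diag0 => //.
  by apply/eqP; have := f0 u => /= /negbFE.
have {}fp : 0 < f p p by rewrite lt_def psd_kernel_diag_ge0 // andbT; exact: fp.
have psdf' := psd_kernel_deflate psdf fp.
have [|s sE] := IH _ _ psdf'.
  apply: leq_trans fn; apply: proper_card; apply/properP; split.
    apply/fintype.subsetP => u; rewrite !inE; apply: contraNneq => fu0.
    by rewrite fu0 psdf.1 psd_kernel_diag0 // mul0r mul0r subr0.
  exists p; rewrite !inE; first by rewrite gt_eqF.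
  by rewrite (mulfK (lt0r_neq0 fp)) subrr eqxx.
exists ((fun u => f p u / Num.sqrt (f p p)) :: s) => u v.
rewrite big_cons -sE mulf_div -expr2 sqr_sqrtr ?ltW //.
by rewrite addrC subrK.
Qed.

(** A product of Gram sums expands into a Gram sum indexed by the choices of one factor per
    coordinate, so the form is a sum of squares. *)
Lemma psd_kernel_tensor_pow f k : psd_kernel f ->
  psd_kernel (fun u v : {ffun 'I_k -> T} => \prod_i f (u i) (v i)).
Proof.
move=> psdf; have [s sE] := psd_kernel_gram psdf.
split=> [u v|z]; first by apply: eq_bigr => i _; rewrite psdf.1.
pose g (h : {ffun 'I_k -> 'I_(size s)}) (u : {ffun 'I_k -> T}) : R :=
  \prod_i nth (fun=> 0) s (h i) (u i).
have E (u v : {ffun 'I_k -> T}) : \prod_i f (u i) (v i) = \sum_h g h u * g h v.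
  transitivity (\prod_i \sum_(j < size s)
      nth (fun=> 0) s j (u i) * nth (fun=> 0) s j (v i)).
    by apply: eq_bigr => i _; rewrite sE (big_nth (fun=> 0)) big_mkord.
  by rewrite bigA_distr_bigA; apply: eq_bigr => h _; rewrite -big_split.
rewrite /bform; under eq_bigr => u _ do under eq_bigr => v _ do
  rewrite E mulr_sumr mulr_suml.
under eq_bigr do rewrite exchange_big.
rewrite exchange_big; apply: sumr_ge0 => h _.
suff -> : \sum_u \sum_v z u * (g h u * g h v) * z v = (\sum_u z u * g h u) ^+ 2.
  exact: sqr_ge0.
rewrite expr2 mulr_suml; apply: eq_bigr => u _.
by rewrite mulr_sumr; apply: eq_bigr => v _; ring.
Qed.

Lemma bform_bounded f : exists K : R, forall z,
  bform f z z <= K * \sum_u z u ^+ 2.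
Proof.
exists (\sum_u \sum_v `|f u v|) => z; rewrite mulr_suml; apply: ler_sum => u _.
rewrite mulr_suml; apply: ler_sum => v _.
have zS t : z t ^+ 2 <= \sum_u z u ^+ 2.
  by rewrite (bigD1 t) //= lerDl sumr_ge0 // => i _; exact: sqr_ge0.
apply: le_trans (ler_norm _) _; rewrite !normrM.
rewrite [_ * `|f u v|]mulrC -mulrA ler_wpM2l //.
have := zS u; have := zS v; rewrite -[z u ^+ 2]real_normK ?num_real //.
rewrite -[z v ^+ 2]real_normK ?num_real //.
have := sqr_ge0 (`|z u| - `|z v|); nra.
Qed.

End PsdKernel.

(** * Largest eigenvalue and group inverse of a symmetric matrix *)

Section SymmetricSpectrum.
Variables (R : realType) (n : nat).

(* The least [l] bounding the Rayleigh quotients of [A] is an eigenvalue:     *)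
(* otherwise [l - A] is invertible and positive, so it dominates a positive   *)
(* multiple of the identity and [l] is not least.                             *)
Lemma rayleigh_le (A : 'M[R]_n) (s : R) (z : 'I_n -> R) : A^T = A ->
  (forall r, eigenvalue A r -> r <= s) ->
  bform (fun i j => A i j) z z <= s * \sum_i z i ^+ 2.
Proof.
move=> AT eigA; set f := fun i j => A i j.
have fC i j : f i j = f j i by rewrite /f -[in LHS]AT mxE.
pose nrm (w : 'I_n -> R) := \sum_i w i ^+ 2.
have nrm0 w : 0 <= nrm w by apply: sumr_ge0 => i _; exact: sqr_ge0.
have nrm_gt0 w : nrm w != 0 -> 0 < nrm w by rewrite lt_def nrm0 andbT.
pose S := [set a : R | forall w, bform f w w <= a * nrm w]%classic.
have [K SK] : exists K, S K by exact: bform_bounded.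
have bform0 w a : nrm w = 0 -> bform f w w <= a * nrm w.
  by move=> w0; have := SK w; rewrite w0 !mulr0.
have [z0|z0] := eqVneq (nrm z) 0; first exact: bform0.
have Slb w : nrm w != 0 -> lbound S (bform f w w / nrm w).
  by move=> w0 a Sa; rewrite ler_pdivrMr ?nrm_gt0 //; exact: Sa.
have Sinf : S (inf S).
  move=> w; have [w0|w0] := eqVneq (nrm w) 0; first exact: bform0.
  rewrite -ler_pdivrMr ?nrm_gt0 //.
  by apply: lb_le_inf; [exists K | exact: Slb].
apply: le_trans (Sinf z) _; rewrite ler_wpM2r //; apply: eigA.
set l := inf S; pose P := l%:M - A.
have PE w v : bform (fun i j => P i j) w v = l * (\sum_i w i * v i) - bform f w v.
  rewrite !bformE mulr_sumr -sumrB; apply: eq_bigr => i _.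
  rewrite mulrCA -mulrBr; congr (_ * _).
  transitivity (\sum_j (l *+ (i == j) * v j - f i j * v j)).
    by apply: eq_bigr => j _; rewrite !mxE -mulrBl.
  rewrite sumrB; congr (_ - _).
  by rewrite (bigD1 i) //= eqxx big1 ?addr0 // => j /negPf ji; rewrite eq_sym ji mul0r.
have psdP : psd_kernel (fun i j => P i j).
  split=> [i j|w]; first by rewrite !mxE -!/(f _ _) fC eq_sym.
  by rewrite PE subr_ge0; under eq_bigr do rewrite -expr2; exact: Sinf.
have [detP|detP] := eqVneq (\det P) 0.
  have /eqP/det0P[v v0 vP] := detP.
  apply/eigenvalueP; exists v => //.
  by apply/esym/eqP; rewrite -mul_mx_scalar -subr_eq0 -mulmxBr vP.
have uP : P \in unitmx by rewrite unitmxE unitfE.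
have [K' hK'] := bform_bounded (fun i j => invmx P i j).
have K'0 : 0 < `|K'| + 1 by rewrite ltr_pwDr.
suff : S (l - (`|K'| + 1)^-1).
  move=> /ge_inf h; have := h (ex_intro _ _ (Slb _ z0)).
  by rewrite -/l lerBrDr gerDl leNgt invr_gt0 K'0.
move=> w; have [w0|w0] := eqVneq (nrm w) 0; first exact: bform0.
have {}w0 := nrm_gt0 _ w0.
(* Cauchy-Schwarz for [P] at [w] and [v = P^-1 w] gives [|w|^4 <= (w, P w) (w, P^-1 w)], and the
   last factor is at most [(|K'| + 1) |w|^2]. *)
pose wc := \col_i w i; pose v i := (invmx P *m wc) i ord0.
have Pv i : \sum_j P i j * v j = w i.
  by have := congr1 (fun B : 'cV_n => B i ord0) (mulKVmx uP wc); rewrite !mxE.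
have vE i : v i = \sum_j invmx P i j * w j.
  by rewrite /v mxE; apply: eq_bigr => j _; rewrite mxE.
have := psd_kernel_cauchy w v psdP.
have -> : bform (fun i j => P i j) w v = nrm w.
  by rewrite bformE; apply: eq_bigr => i _; rewrite Pv expr2.
have -> : bform (fun i j => P i j) v v = bform (fun i j => invmx P i j) w w.
  by rewrite !bformE; apply: eq_bigr => i _; rewrite Pv -vE mulrC.
have -> : bform (fun i j => P i j) w w = l * nrm w - bform f w w.
  by rewrite PE; under eq_bigr do rewrite -expr2.
set D := l * nrm w - bform f w w => h.
have D0 : 0 <= D by rewrite subr_ge0; exact: Sinf.
have {}h : nrm w ^+ 2 <= D * (`|K'| + 1) * nrm w.
  apply: le_trans h _; rewrite -mulrA ler_wpM2l //.
  apply: le_trans (hK' w) _; rewrite ler_wpM2r ?nrm0 //.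
  by have := ler_norm K'; lra.
move: h; rewrite expr2 ler_pM2r // -ler_pdivrMr // mulrBl.
by rewrite [_^-1 * _]mulrC /D => ?; lra.
Qed.

(* [M ^+ 2] and [M] have the same kernel, hence the same row space.           *)
Lemma sym_group_inverse (M : 'M[R]_n) : M^T = M ->
  exists X, is_group_inverse M X.
Proof.
move=> MT.
have ker0 (U : 'M[R]_n) : M *m M *m U = 0 -> M *m U = 0.
  move=> MMU; apply/matrixP => i j; rewrite [RHS]mxE.
  have : ((M *m U)^T *m (M *m U)) j j = 0.
    by rewrite trmx_mul MT -!mulmxA (mulmxA M) MMU mulmx0 mxE.
  rewrite mxE; under eq_bigr do rewrite [_^T _ _]mxE -expr2.
  move=> /eqP; rewrite psumr_eq0 => [/allP h|k _]; last exact: sqr_ge0.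
  by apply/eqP; rewrite -sqrf_eq0; apply: h; rewrite mem_index_enum.
have /submxP[W MW] : (M <= M *m M)%MS by rewrite submxE; apply/eqP/ker0; exact: mulmx_coker.
(* Transposing [M = W M^2] gives [M = M^2 W^T], hence [M W^T = W M]; the inverse is [W M W^T]. *)
have MZ : M = M *m M *m W^T by rewrite -[LHS]MT {1}MW !trmx_mul MT.
have MZW : M *m W^T = W *m M by rewrite {1}MW -!mulmxA (mulmxA M) -MZ.
have MX : M *m (W *m M *m W^T) = W *m M.
  by rewrite -MZW !mulmxA -MZ.
have XM : W *m M *m W^T *m M = W *m M by rewrite -(mulmxA W) MZW -!mulmxA -MW.
exists (W *m M *m W^T); split.
- by rewrite MX -mulmxA -MW.
- by rewrite XM -(mulmxA W M (_ *m _)) MX -[in LHS]MZW mulmxA.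
- by rewrite MX XM.
Qed.

End SymmetricSpectrum.

(** * Independent sets in a graph and in its strong powers *)

Section IndependentSets.
Variables (R : realType).

Lemma independentP (G : sgraph) (S : {set G}) :
  reflect (forall u v, u \in S -> v \in S -> ~~ adj u v) (independent S).
Proof.
apply: (iffP forall_inP) => [h u v uS vS|h u uS].
  by move/forall_inP : (h u uS); exact.
by apply/forall_inP => v vS; exact: h.
Qed.

Lemma sum_in_indic (T : finType) (S : {set T}) (F : T -> R) :
  \sum_u (u \in S)%:R * F u = \sum_(u in S) F u.
Proof.
by rewrite [RHS]big_mkcond; apply: eq_bigr => u _; case: ifP; rewrite ?mul1r ?mul0r.
Qed.

(** Cauchy-Schwarz for [1_S] and [w]: the mixed form is [#|S|] because [f w = 1], and independence
    leaves only diagonal terms in the form at [1_S]. *)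
Lemma independent_card_le (G : sgraph) (f : G -> G -> R) (w : G -> R) (a : R)
    (S : {set G}) :
  psd_kernel f -> 0 <= a -> (forall u, f u u <= a) ->
  (forall u v, u != v -> ~~ adj u v -> f u v = 0) ->
  (forall u, \sum_v f u v * w v = 1) -> independent S ->
  #|S|%:R <= a * \sum_u w u.
Proof.
move=> psdf a0 fa f0 fw /independentP iS.
have ww : bform f w w = \sum_u w u.
  by rewrite bformE; apply: eq_bigr => u _; rewrite fw mulr1.
have w0 : 0 <= \sum_u w u by rewrite -ww; exact: psdf.2.
have Sw : bform f (fun u => (u \in S)%:R) w = #|S|%:R.
  rewrite bformE sum_in_indic; under eq_bigr do rewrite fw.
  by rewrite sumr_const.
have SS : bform f (fun u => (u \in S)%:R) (fun u => (u \in S)%:R) <= a * #|S|%:R.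
  rewrite bformE sum_in_indic mulr_natr -sumr_const; apply: ler_sum => u uS.
  rewrite (bigD1 u) //= uS mulr1 big1 ?addr0 // => v vu.
  have [vS|] := boolP (v \in S); last by rewrite mulr0.
  by rewrite f0 ?mul0r 1?eq_sym // iS.
have := psd_kernel_cauchy (fun u => (u \in S)%:R) w psdf; rewrite Sw ww => h.
have [S0|S0] := eqVneq (#|S|%:R : R) 0; first by rewrite S0 mulr_ge0.
have {S0} Sgt : 0 < #|S|%:R :> R by rewrite lt_def S0 /=.
rewrite -(ler_pM2l Sgt) -expr2 (le_trans h) //.
by rewrite mulrA ler_wpM2r // mulrC.
Qed.

Lemma alpha_le (G : sgraph) (n : nat) :
  (forall S : {set G}, independent S -> (#|S| <= n)%N) -> (alpha G <= n)%N.
Proof. by move=> h; apply/bigmax_leqP. Qed.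

Lemma card_le_alpha (G : sgraph) (S : {set G}) :
  independent S -> (#|S| <= alpha G)%N.
Proof. by move=> iS; exact: (leq_bigmax_cond (F := fun S : {set G} => #|S|)). Qed.

(** The witness is [C^k]: letters taken from [C] are never adjacent, so adjacent words over [C]
    would be equal. *)
Lemma alpha_strong_power_ge (G : sgraph) (C : {set G}) k :
  independent C -> (#|C| ^ k <= alpha (strong_power G k))%N.
Proof.
move=> /independentP iC.
pose D : {set strong_power G k} := [set u : {ffun 'I_k -> G} | u \in ffun_on C].
have <- : #|D| = (#|C| ^ k)%N by rewrite cardsE card_ffun_on card_ord.
apply: card_le_alpha; apply/independentP => u v; rewrite !inE.
move=> /ffun_onP uC /ffun_onP vC; apply/negP => /andP[uv /forallP auv].
case/negP: uv; apply/eqP/ffunP => i; apply/eqP.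
by have := auv i; rewrite (negPf (iC _ _ (uC i) (vC i))) orbF.
Qed.

(** [independent_card_le] applies to the tensor powers of [f] and [w]: distinct nonadjacent words
    have a coordinate with distinct nonadjacent letters, which kills the product. *)
Lemma alpha_strong_power_le (G : sgraph) (f : G -> G -> R) (w : G -> R) (a : R)
    (t k : nat) :
  psd_kernel f -> 0 <= a -> (forall u, f u u <= a) ->
  (forall u v, u != v -> ~~ adj u v -> f u v = 0) ->
  (forall u, \sum_v f u v * w v = 1) -> a * \sum_u w u = t%:R ->
  (alpha (strong_power G k) <= t ^ k)%N.
Proof.
move=> psdf a0 fa f0 fw at_; apply: alpha_le => S iS.
rewrite -(ler_nat R) natrX -at_ exprMn.
have -> : (\sum_u w u) ^+ k = \sum_(u : {ffun 'I_k -> G}) \prod_i w (u i).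
  by rewrite -(bigA_distr_bigA (fun=> w)) prodr_const card_ord.
apply: (@independent_card_le (strong_power G k)
  (fun u v : {ffun 'I_k -> G} => \prod_i f (u i) (v i))) => //.
- exact: psd_kernel_tensor_pow.
- exact: exprn_ge0.
- move=> u; rewrite -[k in a ^+ k]card_ord -prodr_const; apply: ler_prod => i _.
  by rewrite fa psd_kernel_diag_ge0.
- move=> u v uv; rewrite /= /pow_adj uv /= negb_forall => /existsP[i].
  rewrite negb_or => /andP[uvi avi].
  by rewrite (bigD1 i) //= f0 ?mul0r.
- move=> u; under eq_bigr do rewrite -big_split /=.
  rewrite -(bigA_distr_bigA (fun i v => f (u i) v * w v)).
  by rewrite big1.
Qed.

Lemma shannon_capacity_eq (G : sgraph) (t : nat) :
  (forall k, alpha (strong_power G k) = t ^ k)%N ->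
  shannon_capacity R G = t%:R.
Proof.
move=> h; apply/cvg_lim => //; apply: cvg_near_cst; near=> k.
(* At [k = 0] the exponent is [0^-1 = 0], so this term is discarded. *)
have k0 : (k%:R : R) != 0 by rewrite pnatr_eq0 -lt0n; near: k; exact: nbhs_infty_gt.
by rewrite h natrX -powR_mulrn // -powRrM divff // powRr1.
Unshelve. all: by end_near.
Qed.

End IndependentSets.

(** * The Lovász theta function *)

Section Lovasz.
Variables (R : realType) (G : sgraph).
Implicit Types (A : 'M[R]_#|G|) (f : G -> G -> R).

Lemma sum_enum_rank (h : 'I_#|G| -> R) : \sum_i h i = \sum_(u : G) h (enum_rank u).
Proof. by rewrite (reindex (@enum_rank G)) //; exact/onW_bij/enum_rank_bij. Qed.

Lemma bform_mx_entry A (z w : 'I_#|G| -> R) :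
  bform (fun i j => A i j) z w =
  bform (mx_entry A) (fun u => z (enum_rank u)) (fun u => w (enum_rank u)).
Proof.
by rewrite /bform sum_enum_rank; apply: eq_bigr => u _; rewrite sum_enum_rank.
Qed.

Lemma psd_mx_entry A : psd A -> psd_kernel (mx_entry A).
Proof.
move=> [AT A0]; split=> [u v|z]; first by rewrite /mx_entry -[in LHS]AT mxE.
have := A0 (\col_i z (enum_val i)); congr (_ <= _).
rewrite -mulmxA mxE sum_enum_rank bformE; apply: eq_bigr => u _.
rewrite !mxE enum_rankK; congr (_ * _).
by rewrite sum_enum_rank; apply: eq_bigr => v _; rewrite mxE enum_rankK.
Qed.

Lemma psd_kernel_scale f (d : G -> R) : psd_kernel f ->
  psd_kernel (fun u v => f u v / (d u * d v)).
Proof.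
move=> [fC f0]; split=> [u v|z]; first by rewrite fC [d v * _]mulrC.
have := f0 (fun u => z u / d u); congr (_ <= _).
apply: eq_bigr => u _; apply: eq_bigr => v _; rewrite invfM; ring.
Qed.

(** Symmetry of [A] turns the row eigenvectors of [eigenvalue] into column ones, here indexed by
    vertices. *)
Lemma eigenvalue_entryP A (r : R) : A^T = A ->
  reflect (exists2 z : G -> R, exists u, z u != 0 &
             forall u, \sum_v mx_entry A u v * z v = r * z u)
          (eigenvalue A r).
Proof.
move=> AT.
have AC u v : mx_entry A u v = mx_entry A v u by rewrite /mx_entry -[in LHS]AT mxE.
apply: (iffP eigenvalueP) => [[v vA v0]|[z [u zu] zA]].
  exists (fun u => v ord0 (enum_rank u)) => [|u].
    have /rV0Pn[i vi] := v0.
    by exists (enum_val i); rewrite enum_valK.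
  have := congr1 (fun B : 'rV_#|G| => B ord0 (enum_rank u)) vA.
  rewrite /= !mxE => <-; rewrite sum_enum_rank; apply: eq_bigr => w _.
  by rewrite AC mulrC.
exists (\row_i z (enum_val i)).
  apply/rowP => i; rewrite !mxE -[i]enum_valK enum_rankK -zA sum_enum_rank.
  by apply: eq_bigr => w _; rewrite AC mxE enum_rankK mulrC.
by apply/rV0Pn; exists (enum_rank u); rewrite mxE enum_rankK.
Qed.

Lemma sum_sqr_gt0 (z : G -> R) u : z u != 0 -> 0 < \sum_v z v ^+ 2.
Proof.
move=> zu; rewrite (bigD1 u) //= ltr_pwDl ?exprn_even_gt0 //.
by apply: sumr_ge0 => v _; exact: sqr_ge0.
Qed.

(** A feasible matrix is all ones on [C], so its form at [1_C] is [#|C|^2], against squared norm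
    [#|C|]. *)
Lemma card_le_lovasz_value (C : {set G}) (s : R) :
  (0 < #|C|)%N -> independent C -> lovasz_values G s -> #|C|%:R <= s.
Proof.
move=> C0 /independentP iC [A [AT A1] [_ sA]].
pose h (i : 'I_#|G|) : R := (enum_val i \in C)%:R.
have := rayleigh_le h AT sA; rewrite bform_mx_entry bformE sum_enum_rank.
have -> : \sum_v h (enum_rank v) ^+ 2 = #|C|%:R.
  rewrite -sumr_const -sum_in_indic; apply: eq_bigr => v _.
  by rewrite /h enum_rankK mulr1; case: (v \in C); rewrite ?expr1n ?expr0n.
under eq_bigr do rewrite /h enum_rankK.
rewrite sum_in_indic (eq_bigr (fun=> #|C|%:R)) => [|v vC]; last first.
  rewrite -sumr_const -sum_in_indic; apply: eq_bigr => w _; rewrite mulr1 /h enum_rankK.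
  have [wC|] := boolP (w \in C); last by rewrite mulr0.
  by rewrite A1 ?mulr1 // iC ?orbT.
rewrite sumr_const -(mulr_natr #|C|%:R) ler_pM2r ?ltr0n //.
Qed.

Lemma lovasz_theta_eq f (c : R) (C : {set G}) :
  psd_kernel f -> 0 < c -> (0 < #|C|)%N -> (forall u, f u u <= c) ->
  (forall u, u \in C -> f u u = c) ->
  (forall u v, u != v -> ~~ adj u v -> f u v = 0) ->
  (forall u, \sum_(v in C) f u v = c) -> independent C ->
  lovasz_theta R G = #|C|%:R.
Proof.
move=> psdf c0 C0 fc fC f0 fsum iC; apply: lovasz_thetaP.
split; last by move=> s; exact: card_le_lovasz_value.
set t : R := #|C|%:R; have t0 : 0 < t by rewrite ltr0n.
(* The last term restores the diagonal entries to [1]. *)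
pose a u v : R := 1 - t / c * f u v + (u == v)%:R * (t / c * f u u).
pose A : 'M[R]_#|G| := \matrix_(i, j) a (enum_val i) (enum_val j).
have AE u v : mx_entry A u v = a u v by rewrite /mx_entry mxE !enum_rankK.
have AT : A^T = A.
  apply/matrixP => i j; rewrite !mxE /a psdf.1.
  by case: (eqVneq (enum_val j) (enum_val i)) => [->|_]; rewrite ?mul0r.
have aE z u : \sum_v a u v * z v =
    \sum_v z v - t / c * \sum_v f u v * z v + t / c * f u u * z u.
  rewrite mulr_sumr -sumrB.
  have -> : t / c * f u u * z u = \sum_v (v == u)%:R * (t / c * f u u * z v).
    by rewrite sum_indic.
  by rewrite -big_split; apply: eq_bigr => v _; rewrite /a /= eq_sym; ring.
exists A; first (split=> // u v; rewrite AE /a).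
  have [<- _|uv /= nuv] := eqVneq u v; first by rewrite mul1r subrK.
  by rewrite f0 // mulr0 mul0r subr0 addr0.
split.
  apply/(eigenvalue_entryP _ AT); exists (fun u => (u \in C)%:R).
    by have /card_gt0P[u uC] := C0; exists u; rewrite uC oner_eq0.
  (* On [1_C] the first two terms of [a] contribute [t] and [- t] and cancel; the diagonal term
     gives [t] on [C] since [f u u = c] there. *)
  move=> u; under eq_bigr do rewrite AE.
  rewrite aE.
  have -> : \sum_v f u v * (v \in C)%:R = c.
    by rewrite -(fsum u) -sum_in_indic; apply: eq_bigr => v _; rewrite mulrC.
  have -> : \sum_(v : G) (v \in C)%:R = t.
    by rewrite /t -sumr_const -sum_in_indic; apply: eq_bigr => v _; rewrite mulr1.
  rewrite divfK ?gt_eqF // subrr add0r.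
  have [uC|] := boolP (u \in C); last by rewrite !mulr0.
  by rewrite fC // divfK ?gt_eqF.
move=> r /(eigenvalue_entryP _ AT)[z [u zu] zA].
rewrite -(ler_pM2r (sum_sqr_gt0 zu)).
have -> : r * \sum_v z v ^+ 2 = \sum_u z u * \sum_v a u v * z v.
  rewrite mulr_sumr; apply: eq_bigr => v _.
  by under [in RHS]eq_bigr do rewrite -AE; rewrite zA; ring.
have Cz : bform f (fun u => (u \in C)%:R) z = c * \sum_v z v.
  rewrite bformC ?psdf.1 // => [|v w]; last exact: psdf.1.
  rewrite bformE mulr_sumr; apply: eq_bigr => v _; rewrite mulrC; congr (_ * _).
  by rewrite -(fsum v) -sum_in_indic; apply: eq_bigr => w _; rewrite mulrC.
have CC : bform f (fun u => (u \in C)%:R) (fun u => (u \in C)%:R) = c * t.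
  rewrite bformE sum_in_indic mulr_natr -sumr_const; apply: eq_bigr => v _.
  by rewrite -(fsum v) -sum_in_indic; apply: eq_bigr => w _; rewrite mulrC.
(* This yields [(sum z)^2 <= (t / c) * bform f z z], so [J - (t / c) f] is nonpositive; the diagonal
   part of [A] is at most [t] because [f u u <= c]. *)
have := psd_kernel_cauchy (fun u => (u \in C)%:R) z psdf; rewrite Cz CC.
have -> : (c * \sum_v z v) ^+ 2 = c * (c * (\sum_v z v) ^+ 2) by ring.
rewrite -mulrA ler_pM2l // mulrC -ler_pdivlMr // => h.
apply: (@le_trans _ _ (\sum_u (z u * \sum_v z v - t / c * (z u * \sum_v f u v * z v)
    + t * z u ^+ 2))).
  apply: ler_sum => v _; rewrite aE mulrDr mulrBr [z v * (t / c * _)]mulrCA lerD2l.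
  have -> : z v * (t / c * f v v * z v) = t * (f v v / c * z v ^+ 2) by ring.
  by rewrite ler_pM2l // ler_piMl ?sqr_ge0 // ler_pdivrMr ?mul1r.
rewrite big_split sumrB /= -mulr_suml -!mulr_sumr -bformE gerDr -expr2 subr_le0.
by apply: le_trans h _; rewrite mulrAC.
Qed.

End Lovasz.

(** * Rescaling [M] by [x] and combining the bounds *)

Theorem theorem4p2 (R : realType) (G : sgraph)
    (M : 'M[R]_#|G|) (x : 'cV[R]_#|G|) (C : {set G}) (c : R)
    (hMx : graph_pair M x)
    (hC : independent C)
    (hdiag : is_diag_mx (principal_submx C M))
    (hc : c = max_ratio M x)
    (hCc : forall v : G, v \in C -> mx_entry M v v / vec_entry x v ^+ 2 = c)
    (hCout : forall v : G, v \notin C ->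
       c * vec_entry x v = \sum_(u in C) mx_entry M v u * (vec_entry x u)^-1) :
  [/\ (alpha G)%:R = shannon_capacity R G,
      shannon_capacity R G = lovasz_theta R G,
      lovasz_theta R G = #|C|%:R
    & #|C|%:R = F M x].
Proof.
have [psdM M0 [y xE] x0] := hMx; set t := #|C|.
pose f (u v : G) := mx_entry M u v / (vec_entry x u * vec_entry x v).
have psdf : psd_kernel f by apply/psd_kernel_scale/psd_mx_entry.
have fc u : f u u <= c.
  rewrite hc /f -expr2.
  exact: (le_bigmax _ (fun u : G => mx_entry M u u / vec_entry x u ^+ 2)).
have fC u : u \in C -> f u u = c by move=> uC; rewrite -(hCc u uC).
have f0 u v : u != v -> ~~ adj u v -> f u v = 0.
  by move=> uv auv; rewrite /f M0 ?mul0r.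
have fsum u : \sum_(v in C) f u v = c.
  (* On [C] independence leaves only the diagonal term; outside, this is the hypothesis on [x]
     divided by [x u]. *)
  have [uC|uC] := boolP (u \in C).
    rewrite (bigD1 u) //= fC // big1 ?addr0 // => v /andP[vC vu].
    by apply: f0; [rewrite eq_sym | move/independentP : hC => ->].
  apply: (mulIf (x0 u)); rewrite hCout // mulr_suml; apply: eq_bigr => v _.
  by rewrite /f invfM mulrA mulrAC divfK.
have c_gt0 (u : G) : 0 < c.
  rewrite lt_def (le_trans (psd_kernel_diag_ge0 u psdf)) // andbT.
  (* If [c = 0], the diagonal of [f] vanishes, hence row [u] of [M], and [x = M y] would vanish at
     [u]. *)
  apply: contraNneq (x0 u) => c0.
  have fu v : f u v = 0.
    apply: (psd_kernel_diag0 _ psdf); apply/le_anti.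
    by rewrite psd_kernel_diag_ge0 // -[in leRHS]c0 fc.
  rewrite /vec_entry xE mxE sum_enum_rank big1 // => v _.
  have := fu v; rewrite /f => /eqP.
  rewrite mulf_eq0 invr_eq0 mulf_eq0 !(negPf (x0 _)) !orbF => /eqP Muv.
  by rewrite -/(mx_entry M u v) Muv mul0r.
have c_ge0 : 0 <= c by rewrite hc /max_ratio; exact: bigmax_ge_id.
pose w (u : G) : R := (u \in C)%:R / c.
have fw u : \sum_v f u v * w v = 1.
  have c_neq0 := lt0r_neq0 (c_gt0 u); apply: (mulIf c_neq0).
  rewrite mul1r -[RHS](fsum u) -sum_in_indic mulr_suml.
  by apply: eq_bigr => v _; rewrite /w mulrA divfK // mulrC.
have wsum : \sum_u w u = t%:R / c.
  by rewrite -mulr_suml -sumr_const -sum_in_indic; under [in RHS]eq_bigr do rewrite mulr1.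
have cw : c * (t%:R / c) = t%:R.
  (* The case [t = 0] covers the graph without vertices, where [c] is [0]. *)
  have [->|] := posnP t; first by rewrite mul0r mulr0.
  by move=> /card_gt0P[u _]; rewrite mulrC divfK // gt_eqF // (c_gt0 u).
have alphaG : alpha G = t.
  apply/eqP; rewrite eqn_leq card_le_alpha // andbT; apply: alpha_le => S iS.
  by rewrite -(ler_nat R) -cw -wsum; exact: independent_card_le fw iS.
have shannonG : shannon_capacity R G = t%:R.
  apply: shannon_capacity_eq => k; apply/eqP.
  rewrite eqn_leq alpha_strong_power_ge // andbT.
  by apply: (alpha_strong_power_le _ psdf c_ge0 fc f0 fw); rewrite wsum.
have thetaG : lovasz_theta R G = t%:R.
  have [u _|G0] := pickP [pred u : G | true]; last first.
    (* Without vertices there are no eigenvectors, so no minimum exists and [lovasz_theta] takes its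
       default value [0]. *)
    have -> : t = 0%N by apply: eq_card0 => u; have := G0 u.
    apply: xgetPN => r [[A [AT _] [/(eigenvalue_entryP _ AT)[z [u _] _] _]] _].
    by have := G0 u.
  apply: (lovasz_theta_eq psdf (c_gt0 u)) => //; rewrite lt0n.
  apply: contraTneq (c_gt0 u) => /cards0_eq C0.
  by rewrite -(fsum u) C0 big_set0 ltxx.
split; rewrite ?alphaG ?shannonG ?thetaG //.
(* Undoing the rescaling, [f w = 1] becomes [M yc = x] with [yc = w / x]. *)
pose yc : 'cV[R]_#|G| := \col_i (w (enum_val i) / vec_entry x (enum_val i)).
have xyc : x = M *m yc.
  apply/colP => i; rewrite -[i]enum_valK mxE sum_enum_rank.
  rewrite -[LHS]mul1r -(fw (enum_val i)) mulr_suml; apply: eq_bigr => v _.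
  rewrite mxE enum_rankK /f -/(mx_entry _ _ _) -/(vec_entry _ _).
  by have := x0 v; have := x0 (enum_val i) => *; field; apply/andP.
have [X MX] := sym_group_inverse psdM.1.
rewrite /F (group_inverseP MX) -hc.
(* Since [M X M = M], the form collapses to [yc^T x], which is the sum of [w]. *)
suff -> : x^T *m X *m x = yc^T *m x.
  rewrite mxE sum_enum_rank -[LHS]cw mulrC -wsum; congr (_ * _).
  apply: eq_bigr => u _; rewrite !mxE enum_rankK -/(vec_entry _ _).
  by rewrite divfK.
have [MXM _ _] := MX.
by rewrite xyc trmx_mul psdM.1 -[in RHS]MXM !mulmxA.
Qed.
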